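(* Let $f:[0,\infty)\to[0,\infty)$ be metric-preserving. Then the following statements are equivalent: 1) $f$ is continuous on $[0,\infty)$; 2) $f$ is continuous at $0$; 3) for every $\varepsilon>0$, there exists an $x>0$ such that $f(x)<\varepsilon$; 4) $f$ is strongly metric-preserving; 5) $f$ is uniformly continuous on $[0,\infty)$; 6) $f$ is weakly continuous on $[0,\infty)$; 7) $f$ is weakly continuous at $0$; 8) $f$ is quasi continuous on $[0,\infty)$; 9) $f$ is quasi continuous at $0$; 10) $f$ is a.c.S. on $[0,\infty)$; 11) $f$ is a.c.S. at $0$; 12) $f$ is a.c.H. on $[0,\infty)$; 13) $f$ is a.c.H. at $0$.
   Context: A function $f:[0,\infty)\to[0,\infty)$ is metric-preserving if for all metric spaces $(X,d)$, $f\circ d$ is a metric on $X$. It is strongly metric-preserving if for every metric $d$, $f\circ d$ is a metric equivalent to $d$ (i.e. topologically equivalent: inducing the same topology). The set $[0,\infty)$ carries its usual topology. Weak continuity: $f$ is weakly continuous at $a\neq 0$ if there are sequences $(x_n)$ and $(y_n)$ in $[0,\infty)$ such that $(x_n)$ is strictly increasing and converges to $a$, $(y_n)$ is strictly decreasing and converges to $a$, and $f(x_n)$ and $f(y_n)$ converge to $f(a)$; $f$ is weakly continuous at $0$ if there is a strictly decreasing sequence $(y_n)$ converging to $0$ such that $f(y_n)$ converges to $f(0)$. For topological spaces $X,Y$ and $g:X\to Y$: $g$ is quasi continuous at $a\in X$ if for all open sets $U$ of $X$ and $V$ of $Y$ with $a\in U$ and $g(a)\in V$, there is a nonempty open set $G$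 of $X$ such that $G\subseteq U$ and $g(G)\subseteq V$. $g$ is a.c.S. at $x$ (almost continuous in the sense of Singal) if for each open set $V$ of $Y$ containing $g(x)$ there exists an open set $U$ containing $x$ such that $g(U)\subseteq \operatorname{Int}(\overline V)$. $g$ is a.c.H. at $x$ (almost continuous in the sense of Husain) if for each open set $V$ of $Y$ containing $g(x)$, $\overline{g^{-1}(V)}$ is a neighborhood of $x$. Each of these properties (including weak continuity) holds on a set $A$ if it holds at every point of $A$. *)

(* Defs.v *)
From HB Require Import structures.
From mathcomp Require Import all_boot all_order all_algebra.
From mathcomp Require Import all_classical all_reals all_analysis.

Set Implicit Arguments.
Unset Strict Implicit.
Unset Printing Implicit Defensive.

Import Order.TTheory GRing.Theory Num.Theory.
Import numFieldNormedType.Exports.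

Local Open Scope classical_set_scope.
Local Open Scope ring_scope.

(* Used as a type through the coercion [set_type], which carries the topology
   and the uniformity induced by the inclusion into [R]. *)
Definition halfline (R : realType) : set R := `[0, +oo[%classic.
Arguments halfline : clear implicits.

Lemma halfline0_subproof (R : realType) : (0 : R) \in halfline R.
Proof. by rewrite inE /halfline /= in_itv /= lexx. Qed.

Definition halfline0 (R : realType) : halfline R :=
  exist _ 0 (halfline0_subproof R).

(* Metrics are unbundled (unlike [metricType]), since several of them are
   compared on the same carrier. *)
Definition is_metric (R : realType) (X : Type) (d : X -> X -> halfline R) :
    Prop :=
  [/\ forall x y, \val (d x y) = 0 <-> x = y,
      forall x y, d x y = d y x &
      forall x y z, \val (d x z) <= \val (d x y) + \val (d y z)].

Definition metric_open (R : realType) (X : Type) (d : X -> X -> halfline R)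
    (U : set X) : Prop :=
  forall x, U x ->
    exists2 e : R, 0 < e & forall y, \val (d x y) < e -> U y.

Definition metric_equivalent (R : realType) (X : Type)
    (d d' : X -> X -> halfline R) : Prop :=
  forall U : set X, metric_open d U <-> metric_open d' U.

Definition metric_preserving (R : realType) (f : halfline R -> halfline R) :
    Prop :=
  forall (X : Type) (d : X -> X -> halfline R),
    is_metric d -> is_metric (fun x y => f (d x y)).

Definition strongly_metric_preserving (R : realType)
    (f : halfline R -> halfline R) : Prop :=
  forall (X : Type) (d : X -> X -> halfline R), is_metric d ->
    is_metric (fun x y => f (d x y)) /\
    metric_equivalent (fun x y => f (d x y)) d.

(* [increasing_seq] and [decreasing_seq] are the strict notions. *)
Definition weakly_continuous_at (R : realType) (f : halfline R -> halfline R)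
    (a : halfline R) : Prop :=
  (a <> halfline0 R ->
    exists x y : nat -> halfline R,
      [/\ increasing_seq (fun n => \val (x n)) /\ x n @[n --> \oo] --> a,
          decreasing_seq (fun n => \val (y n)) /\ y n @[n --> \oo] --> a,
          f (x n) @[n --> \oo] --> f a &
          f (y n) @[n --> \oo] --> f a]) /\
  (a = halfline0 R ->
    exists y : nat -> halfline R,
      [/\ decreasing_seq (fun n => \val (y n)),
          y n @[n --> \oo] --> a &
          f (y n) @[n --> \oo] --> f a]).

Definition quasi_continuous_at (X Y : topologicalType) (g : X -> Y) (a : X) :
    Prop :=
  forall (U : set X) (V : set Y), open U -> open V -> U a -> V (g a) ->
    exists G : set X, [/\ open G, G !=set0, G `<=` U & g @` G `<=` V].

(* almost continuity in the sense of Singal *)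
Definition acS_at (X Y : topologicalType) (g : X -> Y) (x : X) : Prop :=
  forall V : set Y, open V -> V (g x) ->
    exists U : set X, [/\ open U, U x & g @` U `<=` (closure V)°].

(* almost continuity in the sense of Husain *)
Definition acH_at (X Y : topologicalType) (g : X -> Y) (x : X) : Prop :=
  forall V : set Y, open V -> V (g x) -> nbhs x (closure (g @^-1` V)).

(* Main.v *)
(** A metric-preserving function [f] vanishes exactly at [0]; applied to
    triples of points of the line and of the plane with the sup norm, it
    satisfies [f a <= f b + f |a - b|] and [f a <= 2 f b] whenever [a <= 2 b].
    The second inequality turns a single small positive value of [f] into
    smallness of [f] near [0], and the first one turns smallness near [0] into
    uniform continuity.  Each of the local conditions at [0] yields arbitrarily
    small values of [f] at positive points. *)
Require Import Defs.
From mathcomp Require Import all_boot all_order all_algebra.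
From mathcomp Require Import all_classical all_reals all_analysis.
From mathcomp Require Import lra.
Import Order.TTheory GRing.Theory Num.Theory.
Import numFieldNormedType.Exports.
Local Open Scope classical_set_scope.
Local Open Scope ring_scope.

(* Otherwise [/=] exposes [proj1_sig], a different atom for [lra]. *)
#[local] Arguments isSub.val_subdef : simpl never.

(** * Points, neighbourhoods and metrics of the half-line *)

Section Halfline.
Context {R : realType}.
Implicit Types (a b x y : halfline R) (e : R).

Lemma halfline_ge0 x : 0 <= \val x.
Proof.
by have := valP x; rewrite inE /halfline /= in_itv /= andbT.
Qed.

Lemma normr_in_halfline (V : normedZmodType R) (v : V) : `|v| \in halfline R.
Proof. by rewrite inE /halfline /= in_itv /= andbT normr_ge0. Qed.

(** Besides giving distances, it turns a real number known to be nonnegative into a point of the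
    half-line. *)
Definition normh {V : normedZmodType R} (v : V) : halfline R :=
  exist _ `|v| (normr_in_halfline V v).

Lemma val_normh (V : normedZmodType R) (v : V) : \val (normh v) = `|v|.
Proof. by []. Qed.

Lemma normh_val x : normh (\val x : R) = x.
Proof. by apply: val_inj; rewrite val_normh ger0_norm// halfline_ge0. Qed.

Lemma normh0 : normh (0 : R) = halfline0 R.
Proof. exact: (normh_val (halfline0 R)). Qed.

Lemma halfline_gt0 x : x <> halfline0 R -> 0 < \val x.
Proof.
move=> x0; rewrite lt_neqAle halfline_ge0 andbT eq_sym; apply/eqP => x0'.
by apply: x0; apply: val_inj.
Qed.

Lemma ball_halflineE a e : ball a e =
  [set x : halfline R | `|\val a - \val x| < e].
Proof. by []. Qed.

Lemma ball_halfline0E e : ball (halfline0 R) e =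
  [set x : halfline R | \val x < e].
Proof.
rewrite ball_halflineE; apply/funext => x.
by rewrite /= sub0r normrN ger0_norm// halfline_ge0.
Qed.

Lemma nbhs_halfline0 e :
  0 < e -> nbhs (halfline0 R) [set x : halfline R | \val x < e].
Proof. by rewrite -ball_halfline0E; exact: nbhsx_ballx. Qed.

Lemma open_halfline_lt e : open [set x : halfline R | \val x < e].
Proof.
rewrite openE => x /= xe; apply/nbhs_ballP; exists (e - \val x) => /=.
  by rewrite subr_gt0.
by move=> y; rewrite ball_halflineE /= ltr_norml => /andP[]; lra.
Qed.

Lemma closure_halfline_lt e x :
  closure [set x : halfline R | \val x < e] x -> \val x <= e.
Proof.
move=> cx; rewrite leNgt; apply/negP => ex.
have xe0 : 0 < \val x - e by rewrite subr_gt0.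
have [y [/= ye]] := cx _ (nbhsx_ballx x _ xe0).
by rewrite ball_halflineE /= ltr_norml => /andP[]; lra.
Qed.

Lemma nbhs_halfline_pos a (A : set (halfline R)) :
  nbhs a A -> exists2 x, A x & 0 < \val x.
Proof.
move=> /nbhs_ballP[e /= e0 aA]; have a0 := halfline_ge0 a.
(* Moving to the right stays in the half-line and gives a positive point even when [a] is 0. *)
have h0 : 0 <= \val a + e / 2 by lra.
exists (normh (\val a + e / 2 : R)); last by rewrite val_normh ger0_norm//; lra.
apply: aA; rewrite ball_halflineE /= val_normh (ger0_norm h0) ltr_norml; lra.
Qed.

Lemma cvg_halfline (u : nat -> halfline R) a :
  (\val (u n) : R) @[n --> \oo] --> (\val a : R) -> u n @[n --> \oo] --> a.
Proof. by move=> /cvg_ballP ua; apply/cvg_ballP => e /ua. Qed.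

Lemma is_metric_normh (V : normedZmodType R) :
  is_metric (fun u v : V => normh (u - v)).
Proof.
split => [u v|u v|u v w].
- by split => [/normr0_eq0/subr0_eq//|->]; rewrite val_normh subrr normr0.
- by apply: val_inj; rewrite !val_normh distrC.
- by rewrite !val_normh (le_trans _ (ler_normD _ _))// addrA subrK.
Qed.

Definition small_values (f : halfline R -> halfline R) : Prop :=
  forall e, 0 < e -> exists x, 0 < \val x /\ \val (f x) < e.

(** Continuity at 0 in epsilon-delta form, once [f] is known to vanish there. *)
Definition small_near0 (f : halfline R -> halfline R) : Prop :=
  forall e, 0 < e ->
    exists2 d : R, 0 < d & forall y, \val y < d -> \val (f y) < e.

(** * Inequalities for metric-preserving functions *)

Section MetricPreserving.
Context (f : halfline R -> halfline R) (hf : metric_preserving f).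

Lemma metric_preserving_eq0 a : \val (f a) = 0 <-> a = halfline0 R.
Proof.
have [+ _ _] := hf _ _ (is_metric_normh R).
move=> /(_ (\val a) 0) /=; rewrite subr0 normh_val => ->.
by split=> [a0|->//]; apply: val_inj.
Qed.

Lemma metric_preserving0 : f (halfline0 R) = halfline0 R.
Proof. by apply: val_inj => /=; apply/metric_preserving_eq0. Qed.

Lemma metric_preserving_gt0 a : 0 < \val a -> 0 < \val (f a).
Proof.
move=> a0; apply: halfline_gt0 => fa0.
have /metric_preserving_eq0 a0' : \val (f a) = 0 by rewrite fa0.
by move: a0; rewrite a0' /= ltxx.
Qed.

Lemma metric_preserving_triangle a b :
  \val (f a) <= \val (f b) + \val (f (normh (\val a - \val b : R))).
Proof.
have [_ _ /(_ (\val a) (\val b) 0)] := hf _ _ (is_metric_normh R).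
by rewrite !subr0 !normh_val addrC.
Qed.

Lemma metric_preserving_isosceles a b :
  \val a <= 2 * \val b -> \val (f a) <= 2 * \val (f b).
Proof.
move=> ab; have [a0 b0] := (halfline_ge0 a, halfline_ge0 b).
(* The triangle 0, [u], [v] has base [a] and two sides [b]: in the sup norm, the height [b] of [v]
   dominates the half base [a / 2]. *)
pose u : R * R := (\val a, 0); pose v : R * R := (\val a / 2, \val b).
have [_ _ /(_ u v 0)] := hf _ _ (is_metric_normh (R * R)%type).
have -> : normh (u - 0) = a.
  apply: val_inj; rewrite subr0 val_normh prod_normE /= normr0 ger0_norm//.
  by apply/max_idPl.
have -> : normh (u - v) = b.
  apply: val_inj; rewrite val_normh prod_normE /= sub0r normrN (ger0_norm b0).
  by apply/max_idPr; rewrite ger0_norm; lra.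
have -> : normh (v - 0) = b.
  apply: val_inj; rewrite subr0 val_normh prod_normE /= (ger0_norm b0).
  by apply/max_idPr; rewrite ger0_norm; lra.
by rewrite mulr2n mulrDl mul1r.
Qed.

(** * Small values, uniform continuity and equivalence of metrics *)

Lemma small_values_near0 : small_values f -> small_near0 f.
Proof.
move=> f3 e e0; have [|x [x0 fx]] := f3 (e / 2); first by lra.
exists (\val x) => // y yx.
have := metric_preserving_isosceles y x; lra.
Qed.

Lemma near0_unif_continuous : small_near0 f -> unif_continuous f.
Proof.
move=> f0 A; rewrite -!entourage_ballE => -[e /= e0 eA].
have [d d0 fd] := f0 _ e0; exists d => //= -[x y] /=.
rewrite ball_halflineE /= => xyd; apply: eA => /=.
have := metric_preserving_triangle x y; have := metric_preserving_triangle y x.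
have <- : normh (\val x - \val y : R) = normh (\val y - \val x : R).
  by apply: val_inj; rewrite !val_normh distrC.
have := fd (normh (\val x - \val y : R)) xyd.
by rewrite ball_halflineE /= ltr_norml; lra.
Qed.

Lemma small_values_unif_continuous : small_values f -> unif_continuous f.
Proof. by move=> /small_values_near0/near0_unif_continuous. Qed.

Lemma unif_continuous_continuous : unif_continuous f -> continuous f.
Proof.
move=> /unif_continuousP fu x A /nbhs_ballP[e /= e0 eA].
have [d /= d0 fd] := fu _ e0; apply/nbhs_ballP.
by exists d => //= y xy; apply: eA; exact: (fd (x, y)).
Qed.

Lemma small_values_continuous : small_values f -> continuous f.
Proof. by move=> /small_values_unif_continuous/unif_continuous_continuous. Qed.

Lemma small_values_strong : small_values f -> strongly_metric_preserving f.
Proof.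
move=> f3 X d dm; split; first exact: hf.
move=> U; split=> oU x /oU[e e0 eU].
- have [r r0 fr] := small_values_near0 f3 _ e0.
  by exists r => // y xy; apply/eU/fr.
- have he : 0 <= e by exact: ltW.
  (* The radius is half of [f e]: if [d x y] were at least [e], then [e <= 2 * d x y], and the
     isosceles inequality would give [f e <= 2 * f (d x y)]. *)
  have fe : 0 < \val (f (normh e)).
    by apply: metric_preserving_gt0; rewrite val_normh ger0_norm.
  exists (\val (f (normh e)) / 2) => [|y xy]; first by lra.
  apply: eU; rewrite ltNge; apply/negP => edxy.
  have := metric_preserving_isosceles (normh e) (d x y).
  by rewrite val_normh ger0_norm//; lra.
Qed.

Lemma strong_near0 : strongly_metric_preserving f -> small_near0 f.
Proof.
move=> fs e e0; have [_ fd] := fs _ _ (is_metric_normh R).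
(* The ball of radius [e] about 0 for the composed metric on the line is open for the usual metric
   too, hence contains a usual ball about 0. *)
have /fd : metric_open (fun u v : R => f (normh (u - v)))
    [set v : R | \val (f (normh (0 - v))) < e].
  move=> v /= ve; exists (e - \val (f (normh (0 - v)))).
    by rewrite subr_gt0.
  have [[_ _ tri] _] := fs _ _ (is_metric_normh R).
  by move=> w vw; apply: le_lt_trans (tri 0 v w) _; lra.
move=> /(_ 0)[|d d0 dU].
  by rewrite /= subr0 normh0 metric_preserving0.
exists d => // y yd; have := dU (- \val y : R).
by rewrite /= !sub0r !opprK normh_val; apply.
Qed.

(** * From continuity to weak continuity *)

Lemma continuous_weakly a : continuous f -> weakly_continuous_at f a.
Proof.
move=> cf; pose h := @harmonic R.
have h0 n : 0 < h n by rewrite /h /= invr_gt0.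
have hd n : h n.+1 < h n by rewrite /h /= ltf_pV2 ?posrE// ltr_nat.
have a0 := halfline_ge0 a.
pose y n : halfline R := normh (\val a + h n : R).
have yE n : \val (y n) = \val a + h n.
  by rewrite val_normh ger0_norm// addr_ge0// ltW.
have yd : decreasing_seq (fun n => \val (y n)).
  by apply/decreasing_seqP => n; rewrite !yE ltrD2l.
have ya : y n @[n --> \oo] --> a.
  apply: cvg_halfline; under eq_fun do rewrite yE.
  have : (\val a + h n : R) @[n --> \oo] --> (\val a + 0 : R).
    by apply: cvgD; [exact: cvg_cst|exact: cvg_harmonic].
  by rewrite addr0.
have fya : f (y n) @[n --> \oo] --> f a by exact: (cvg_comp _ _ ya (cf a)).
split=> [/halfline_gt0 agt0|_]; last by exists y.
(* Subtracting a multiple of [a] keeps the sequence in the half-line; with the shifted index the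
   factor [1 - h n.+1] is positive. *)
pose x n : halfline R := normh (\val a - \val a * h n.+1 : R).
have h1 n : h n.+1 < 1 by rewrite /h /= invf_lt1// ltr1n.
have xE n : \val (x n) = \val a - \val a * h n.+1.
  by rewrite val_normh ger0_norm// subr_ge0 ler_piMr// ltW.
have xa : x n @[n --> \oo] --> a.
  apply: cvg_halfline; under eq_fun do rewrite xE.
  have : (\val a - \val a * h n.+1 : R) @[n --> \oo] -->
      (\val a - \val a * 0 : R).
    apply: cvgB; first exact: cvg_cst.
    apply: cvgM; first exact: cvg_cst.
    by move: (@cvg_harmonic R); rewrite -cvg_shiftS.
  by rewrite mulr0 subr0.
exists x, y; split=> //; last exact: (cvg_comp _ _ xa (cf a)).
split=> //; apply/increasing_seqP => n.
by rewrite !xE ltrD2l ltrN2 ltr_pM2l.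
Qed.

(** * Each local condition at 0 gives small values *)

Lemma weakly_small_values :
  weakly_continuous_at f (halfline0 R) -> small_values f.
Proof.
move=> [_ /(_ erefl)[y [yd _ fy]]] e e0.
move: fy; rewrite metric_preserving0.
move=> /(_ _ (nbhs_halfline0 _ e0))[N _ /(_ N (leqnn N)) yN].
exists (y N); split=> //.
(* Strict decrease makes [y N] exceed the nonnegative [y N.+1]. *)
have /decreasing_seqP := yd.
by move=> /(_ N); apply: le_lt_trans; exact: halfline_ge0.
Qed.

Lemma cont0_small_values :
  {for halfline0 R, continuous f} -> small_values f.
Proof.
move=> f0 e e0.
have : nbhs (f (halfline0 R)) [set x : halfline R | \val x < e].
  by rewrite metric_preserving0; exact: nbhs_halfline0.
by move=> /f0/nbhs_halfline_pos[x]; exists x.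
Qed.

Lemma quasi_small_values :
  quasi_continuous_at f (halfline0 R) -> small_values f.
Proof.
move=> f0 e e0.
have [||G [oG [x Gx] _ fG]] :=
  f0 setT [set x : halfline R | \val x < e] openT (open_halfline_lt e) => //.
  by rewrite metric_preserving0.
(* The point [x] of [G] may be 0, but the open set [G] then also contains a positive point. *)
have [y Gy y0] := nbhs_halfline_pos _ _ (open_nbhs_nbhs (conj oG Gx)).
by exists y; split=> //; apply: fG; exists y.
Qed.

Lemma acS_small_values : acS_at f (halfline0 R) -> small_values f.
Proof.
(* Halving [e] absorbs the closure, which only yields a non-strict bound. *)
move=> f0 e e0; have e20 : 0 < e / 2 by lra.
have [|U [oU U0 fU]] := f0 [set x : halfline R | \val x < e / 2]
  (open_halfline_lt _).
  by rewrite metric_preserving0.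
have [y Uy y0] := nbhs_halfline_pos _ _ (open_nbhs_nbhs (conj oU U0)).
exists y; split=> //.
have /interior_subset/closure_halfline_lt : (closure
  [set x : halfline R | \val x < e / 2])° (f y) by apply: fU; exists y.
by lra.
Qed.

Lemma acH_small_values : acH_at f (halfline0 R) -> small_values f.
Proof.
move=> f0 e e0.
have := f0 [set x : halfline R | \val x < e] (open_halfline_lt _).
rewrite /= metric_preserving0 => /(_ e0)/nbhs_halfline_pos[x cx x0].
(* Only the closure of the preimage is known to contain [x]; a point of the preimage at distance
   less than [x] from [x] is still positive. *)
have [y [/= fy xy]] := cx _ (nbhsx_ballx x _ x0).
exists y; split=> //.
by move: xy; rewrite ball_halflineE /= ltr_norml => /andP[]; lra.
Qed.

End MetricPreserving.
End Halfline.

(** * Continuity implies the generalized notions; the equivalence *)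

Lemma continuous_quasi (X Y : topologicalType) (g : X -> Y) (a : X) :
  continuous g -> quasi_continuous_at g a.
Proof.
move=> /continuousP cg U V oU oV Ua Vga; exists (U `&` g @^-1` V); split.
- by apply: openI => //; exact: cg.
- by exists a.
- exact: subIsetl.
- by move=> _ [x [_ Vgx] <-].
Qed.

Lemma continuous_acS (X Y : topologicalType) (g : X -> Y) (a : X) :
  continuous g -> acS_at g a.
Proof.
move=> /continuousP cg V oV Vga; exists (g @^-1` V); split=> //.
  exact: cg.
have Vcl : V `<=` (closure V)°.
  by rewrite -open_subsetE//; exact: subset_closure.
by move=> _ [x Vgx <-]; exact: Vcl.
Qed.

Lemma continuous_acH (X Y : topologicalType) (g : X -> Y) (a : X) :
  {for a, continuous g} -> acH_at g a.
Proof.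
move=> cg V oV Vga; apply: filterS (@subset_closure _ _) _.
by apply: cg; exact: open_nbhs_nbhs.
Qed.

Theorem theorem25 (R : realType) (f : halfline R -> halfline R)
    (hf : metric_preserving f) :
  [<-> continuous f;
       {for halfline0 R, continuous f};
       forall e : R, 0 < e ->
         exists x : halfline R, 0 < \val x /\ \val (f x) < e;
       strongly_metric_preserving f;
       unif_continuous f;
       forall a : halfline R, weakly_continuous_at f a;
       weakly_continuous_at f (halfline0 R);
       forall a : halfline R, quasi_continuous_at f a;
       quasi_continuous_at f (halfline0 R);
       forall a : halfline R, acS_at f a;
       acS_at f (halfline0 R);
       forall a : halfline R, acH_at f a;
       acH_at f (halfline0 R)].
Proof.
have sc := small_values_continuous _ hf.
(* The implications form one cycle: each generalized continuity at 0 leads through small values back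
   to continuity, by [sc], and from there to the next global notion. *)
tfae=> [cf|cf|sf|sf|uf a|wf|wf a|qf|qf a|sf|sf a|Hf|Hf].
- exact: cf.
- exact: (cont0_small_values _ hf).
- exact: (small_values_strong _ hf).
- exact/(near0_unif_continuous _ hf)/(strong_near0 _ hf).
- exact/(continuous_weakly _)/unif_continuous_continuous.
- exact: wf.
- exact/continuous_quasi/sc/(weakly_small_values _ hf).
- exact: qf.
- exact/continuous_acS/sc/(quasi_small_values _ hf).
- exact: sf.
- exact/continuous_acH/sc/(acS_small_values _ hf).
- exact: Hf.
- exact/sc/(acH_small_values _ hf).
Qed.
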